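(* For all $m,n\in\mathbb{N}$, $\mathcal{H}_m\cap\mathcal{H}_n=\mathcal{H}_{\mathrm{LCM}(m,n)}$, where $\mathrm{LCM}(m,n)$ is the least common multiple of $m$ and $n$.
   Context: $\mathbb{N}$ denotes the positive integers and $\langle x\rangle=x-[x]$ the fractional part of $x\in\mathbb{R}$. For $m\in\mathbb{N}$, $$\mathcal{H}_m=\Big\{\alpha\in\mathbb{R}\;:\;\mathrm{card}\{1\le k\le n : \langle k\alpha\rangle<\tfrac1m\}\ge \tfrac nm\ \text{ for all } n\in\mathbb{N}\Big\}.$$ *)

(* Defs.v *)
From mathcomp Require Import all_boot all_order all_algebra.
From mathcomp Require Import classical_sets reals.

Set Implicit Arguments.
Unset Strict Implicit.
Unset Printing Implicit Defensive.

Import Order.TTheory GRing.Theory Num.Theory.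

Local Open Scope classical_set_scope.
Local Open Scope ring_scope.

Definition frac_part {R : realType} (x : R) : R := x - (Num.floor x)%:~R.

(* [k] ranges over ['I_n.+1], i.e. 0 <= k <= n, hence the guard [0 < k].
   The set is meaningful for [0 < m] only. *)
Definition heavy_set (R : realType) (m : nat) : set R :=
  [set alpha : R | forall n : nat, (0 < n)%N ->
     n%:R / m%:R <=
     #|[pred k : 'I_n.+1 |
         (0 < k)%N && (frac_part (k%:R * alpha) < 1 / m%:R)]|%:R :> R].
Arguments heavy_set R m : clear implicits.

(* Main.v *)
Require Import Defs.
From mathcomp Require Import all_boot all_order all_algebra.
From mathcomp Require Import classical_sets reals.
From mathcomp Require Import zify ring lra.

(** Write {t} for the fractional part of t, and call q > 0 a best lower
denominator of alpha when {q alpha} < {k alpha} for all 0 < k < q.  The set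
H_m is characterised arithmetically ([heavy_set_best_lowerP]): alpha lies in
H_m if and only if every best lower denominator q of alpha satisfies
q = 1 mod m.  As lcm(m, n) divides q - 1 exactly when both m and n do, the
theorem follows at once.

Necessity ([heavy_best_lower]).  Let q be a best lower denominator, p the floor
of q alpha.  For 0 < k < q, minimality of {q alpha} makes {k alpha} < 1/m force
k p mod q to be less than q/m.  Since p is prime to q, at most (q-1)/m rounded
down of the k < q have this property; heaviness at n = q - 1 then forces m to
divide q - 1.

Sufficiency ([heavy_farey_approx], [lower_good_near]).  The number alpha is
squeezed between x/q' <= alpha < y/q'', a Farey pair (q' y - q'' x = 1) with
q' = 1 mod m and q'' = 0 mod m.  Writing P = (q', x) and Q = (q'', y), the pair
(P, Q) can be refined to (P + Q, Q) if P + Q still lies below alpha, and to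
(P, Q + m P) otherwise: were one of the intermediate vectors
Q + 2P, ..., Q + mP below alpha, the first such would be a best lower
denominator with a forbidden residue.  Along these refinements two facts are
carried together:
 - x/q' is heavy: for all n, at least n/m of the k <= n have {k x/q'} < 1/m;
 - y/q'' is light: for all n, at most n/m of the k <= n have {-k y/q''} < 1/m.
Each refinement step ([heavy_lower_next], [light_upper_next]) combines three
tools: whether k counts is inherited from the old fractions for small k,
large k are turned into small ones by the reflection k -> q - k, and the
counted set is periodic in k.  The conditions for two fractions are compared by expressing
(k, z) in the basis (P, Q) of the integer lattice; the congruences on q' and
q'' are what makes the thresholds for the coordinates of the two fractions
match.  Finally {k alpha} < 1/m follows from {k x/q'} < 1/m as long as
k < q' + q''/m, a bound that grows at each refinement, so the heaviness of
the lower fractions passes to alpha. *)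

Set Implicit Arguments.
Unset Strict Implicit.
Unset Printing Implicit Defensive.

Import Order.TTheory GRing.Theory Num.Theory.

Local Open Scope classical_set_scope.
Local Open Scope ring_scope.

(** * Counting along initial segments *)

Definition hits (f : nat -> bool) (n : nat) : nat := (\sum_(1 <= k < n.+1) f k)%N.

Lemma hitsD f a b : hits f (a + b) = (hits f a + hits (fun k => f (a + k)%N) b)%N.
Proof.
rewrite /hits (@big_cat_nat _ _ _ a.+1) //=; last by rewrite ltnS leq_addr.
congr addn; rewrite -[a.+1]add1n big_addn -addnS addKn.
by apply: eq_bigr => k _; rewrite addnC.
Qed.

Lemma hits_mono (f g : nat -> bool) n :
  (forall k, (0 < k <= n)%N -> f k -> g k) -> (hits f n <= hits g n)%N.
Proof.
move=> fg; rewrite /hits big_nat_cond [leqRHS]big_nat_cond.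
apply: leq_sum => k /andP[kn _].
by case fk: (f k) => //; rewrite (fg k).
Qed.

Lemma eq_hits (f g : nat -> bool) n :
  (forall k, (0 < k <= n)%N -> f k = g k) -> hits f n = hits g n.
Proof. by move=> fg; apply: eq_big_nat => k kn; rewrite fg. Qed.

Lemma hits_rev f n : hits f n = hits (fun k => f (n.+1 - k)%N) n.
Proof. by rewrite /hits big_nat_rev; apply: eq_bigr => k _; congr (nat_of_bool (f _)); lia. Qed.

Lemma hits_split (f : nat -> bool) q : (0 < q)%N ->
  (\sum_(k < q) f k = f 0 + hits f q.-1)%N.
Proof.
by case: q => // q _; rewrite -(big_mkord xpredT (fun k => nat_of_bool (f k))) big_nat_recl //= /hits big_add1.
Qed.

Lemma periodic_many (f : nat -> bool) m q : (0 < q)%N -> (forall k, f (q + k)%N = f k) ->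
  (forall n, (n <= q)%N -> (n <= m * hits f n)%N) ->
  forall n, (n <= m * hits f n)%N.
Proof.
move=> q0 fq H; elim/ltn_ind => n IH; case: (leqP n q) => [/H //|qn].
rewrite -(subnKC (ltnW qn)) hitsD (eq_hits (g := f)) // mulnDr.
by apply: leq_add; [exact: H | apply: IH; lia].
Qed.

(** The bound N leaves room for functions that are periodic, and only in one
direction, on an initial segment. *)
Lemma periodic_few (f : nat -> bool) m q N : (0 < q)%N ->
  (forall k, (0 < k)%N -> (q + k <= N)%N -> f (q + k)%N -> f k) ->
  (forall n, (n <= q)%N -> (m * hits f n <= n)%N) ->
  forall n, (n <= N)%N -> (m * hits f n <= n)%N.
Proof.
move=> q0 fq H; elim/ltn_ind => n IH nN; case: (leqP n q) => [/H //|qn].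
rewrite -[leqRHS](subnKC (ltnW qn)) -{1}(subnKC (ltnW qn)) hitsD mulnDr.
apply: leq_add; first exact: H.
apply: leq_trans (IH (n - q)%N _ _); try lia.
by rewrite leq_mul2l (@hits_mono _ f) ?orbT // => k kn; apply: fq; lia.
Qed.

(** * Multiples of a fraction that fall close above an integer *)

(** For q > 0 this says {k p/q} < 1/m; with - p in place of p it says that
k p/q is an integer or falls short of one by less than 1/m. *)
Definition good (m : nat) (p : int) (q k : nat) : bool :=
  m%:Z * ((k%:Z * p) %% q%:Z)%Z < q%:Z.

(** The remainder is replaced by an arbitrary integer witness z: in this form
k determines a lattice vector (k, z) that can be compared with several
fractions at once. *)
Lemma goodP m p q k : (0 < m)%N -> (0 < q)%N ->
  reflect (exists2 z : int, 0 <= k%:Z * p - z * q%:Z & m%:Z * (k%:Z * p - z * q%:Z) < q%:Z)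
          (good m p q k).
Proof.
move=> m0 q0; apply: (iffP idP) => [g|[z z0 zq]].
  exists ((k%:Z * p) %/ q%:Z)%Z.
    have := modz_ge0 (k%:Z * p) (d := q%:Z); rewrite /modz; lia.
  by move: g; rewrite /good /modz.
rewrite /good.
have -> : k%:Z * p = z * q%:Z + (k%:Z * p - z * q%:Z) by lia.
rewrite modzMDl modz_small // z0 /=; nia.
Qed.

Lemma good_period m p q k : good m p q (q + k) = good m p q k.
Proof. by rewrite /good PoszD mulrDl [q%:Z * p]mulrC modzMDl. Qed.

Lemma good_rev m p q k : (k <= q)%N -> good m p q (q - k) = good m (- p) q k.
Proof.
move=> kq; rewrite /good -subzn // mulrBl.
have -> : q%:Z * p - k%:Z * p = p * q%:Z + (k%:Z * - p) by lia.
by rewrite modzMDl.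
Qed.

Lemma good0 m p q : (0 < q)%N -> good m p q 0.
Proof. by move=> q0; rewrite /good mul0r mod0z mulr0; lia. Qed.

Lemma count_multiples m r : (0 < m)%N -> (\sum_(j < r.+1) (m * j < r.+1) = (r %/ m).+1)%N.
Proof.
move=> m0.
rewrite -(big_mkord xpredT (fun j => nat_of_bool (m * j < r.+1)%N)).
have le : ((r %/ m).+1 <= r.+1)%N by rewrite ltnS leq_div.
rewrite (@big_cat_nat _ _ _ (r %/ m).+1) //=.
rewrite [X in (_ + X)%N]big_nat_cond [X in (_ + X)%N]big1 => [|j /andP[/andP[jr _] _]]; last first.
  by rewrite ltnS mulnC -leq_divRL // leqNgt jr.
rewrite addn0 (eq_big_nat _ _ (F2 := fun=> 1%N)) => [|j /andP[_ jr]].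
  by rewrite sum_nat_const_nat subn0 muln1.
by rewrite ltnS mulnC -leq_divRL // -ltnS jr.
Qed.

(** For p prime to the denominator, k -> k p permutes the residues, so that
the count is that of the positive multiples of m below the denominator. *)
Lemma good_total m p r : (0 < m)%N -> coprimez p r.+1%:Z ->
  hits (good m p r.+1) r = (r %/ m)%N.
Proof.
move=> m0 cop; apply: succn_inj.
have <- : (\sum_(k < r.+1) good m p r.+1 k = (hits (good m p r.+1) r).+1)%N.
  by rewrite hits_split // good0.
rewrite -count_multiples //.
pose h (k : 'I_r.+1) : 'I_r.+1 := inord `|((k%:Z * p) %% r.+1%:Z)%Z|.
have hE k : (h k)%:Z = ((k%:Z * p) %% r.+1%:Z)%Z.
  have ge := modz_ge0 (k%:Z * p) (d := r.+1%:Z) isT.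
  have lt := ltz_pmod (k%:Z * p) (d := r.+1%:Z) isT.
  rewrite inordK; lia.
have hinj : injective h.
  move=> i j /(congr1 (fun t : 'I_r.+1 => t%:Z)); rewrite !hE => /eqP.
  rewrite eqz_mod_dvd -mulrBl Gauss_dvdzl; last by rewrite coprimez_sym.
  rewrite -eqz_mod_dvd !modz_small; try by have := ltn_ord i; have := ltn_ord j; lia.
  by move=> /eqP[] /val_inj.
rewrite [RHS](reindex_inj hinj) /=; apply: eq_bigr => k _.
by rewrite /good -hE.
Qed.

(** Reflection k -> q - k exchanges the beginning for p with the end for - p;
the total count over a period turns lower bounds for one into upper bounds for
the other. *)
Lemma hits_good_rev m p r n : (0 < m)%N -> coprimez p r.+1%:Z -> (n <= r)%N ->
  (hits (good m p r.+1) n + hits (good m (- p) r.+1) (r - n) = r %/ m)%N.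
Proof.
move=> m0 cop nr; rewrite -(good_total m0 cop).
rewrite -[X in _ = hits _ X](subnKC nr) hitsD; congr addn; rewrite [RHS]hits_rev; apply: eq_hits => k kn.
rewrite -good_rev; last lia.
by congr good; lia.
Qed.

(** * Farey pairs with prescribed residues *)

(** The fractions x / (m b + 1) < y / (m c), adjacent in the Farey sense, with
denominators congruent to 1 and 0 modulo m. *)
Definition farey (m b c : nat) (x y : int) : Prop :=
  [/\ (0 < m)%N, (0 < c)%N & y * (m * b).+1%:Z - x * (m * c)%:Z = 1].

Definition heavy_lower m b x := forall n, (n <= m * hits (good m x (m * b).+1) n)%N.
Definition light_upper m c y := forall n, (m * hits (good m (- y) (m * c)) n <= n)%N.

(** Here k is the first entry of u P - d Q.  The bound on u uses the residues:
at the extreme values u = c + 1, d = b the first entry is exactly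
(m b + 1) + c, the bound imposed on k. *)
Lemma lower_good_coord (m b c : nat) (u d k : int) :
  0 < k < (m * b).+1%:Z + c%:Z -> 0 <= d <= b%:Z ->
  k = u * (m * b).+1%:Z - d * (m * c)%:Z -> 1 <= u <= c%:Z.
Proof.
move=> /andP[k0 kq] /andP[d0 db] ke; apply/andP; split.
  have : 0 < u * (m * b).+1%:Z by nia.
  by rewrite pmulr_lgt0 //; lia.
rewrite leNgt; apply/negP => uc.
have h1 : (c%:Z + 1) * (m * b).+1%:Z <= u * (m * b).+1%:Z by rewrite ler_wpM2r //; lia.
have h2 : d * (m * c)%:Z <= b%:Z * (m * c)%:Z by rewrite ler_wpM2r.
lia.
Qed.

(** Inheritance for small k, from x / (m b + 1) to the mediant; d and u are the
determinants of (k, z) with P and Q, and d + u is the one with P + Q. *)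
Lemma lower_good_next m b c x y k : farey m b c x y -> (0 < k <= (m * b).+1)%N ->
  good m x (m * b).+1 k -> good m (x + y) (m * (b + c)).+1 k.
Proof.
move=> [m0 c0 e] k0 /goodP[] // z z0 zm.
set d := k%:Z * x - z * (m * b).+1%:Z in z0 zm.
have db : d <= b%:Z by nia.
pose u := k%:Z * y - z * (m * c)%:Z.
have ke : k%:Z = u * (m * b).+1%:Z - d * (m * c)%:Z.
  by rewrite -[LHS]mulr1 -e /u /d; ring.
have /andP[u1 uc] : 1 <= u <= c%:Z by apply: lower_good_coord ke; lia.
apply/goodP => //; exists z.
  by apply: le_trans (_ : 0 <= d + u) _; [lia | rewrite /d /u; lia].
have -> : k%:Z * (x + y) - z * (m * (b + c)).+1%:Z = d + u by rewrite /d /u; lia.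
nia.
Qed.

(** The same comparison with the refined upper fraction, whose determinant with
(k, z) is u + m d. *)
Lemma lower_good_upper m b c x y k : farey m b c x y -> (0 < k < (m * b).+1 + c)%N ->
  good m x (m * b).+1 k -> good m (y + m%:Z * x) (m * (c + (m * b).+1)) k.
Proof.
move=> [m0 c0 e] k0 /goodP[] // z z0 zm.
set d := k%:Z * x - z * (m * b).+1%:Z in z0 zm.
have db : d <= b%:Z by nia.
pose u := k%:Z * y - z * (m * c)%:Z.
have ke : k%:Z = u * (m * b).+1%:Z - d * (m * c)%:Z.
  by rewrite -[LHS]mulr1 -e /u /d; ring.
have /andP[u1 uc] : 1 <= u <= c%:Z by apply: lower_good_coord ke; lia.
have E : k%:Z * (y + m%:Z * x) - z * (m * (c + (m * b).+1))%:Z = u + m%:Z * d.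
  by rewrite /d /u !PoszM PoszD -[(m * b).+1]addn1 PoszD PoszM; ring.
apply/goodP => //; first lia.
exists z; rewrite E; nia.
Qed.

(** For the upper fractions the inheritance goes backwards: what is good for the
new fraction was good for the old one.  Here (k, - z) = v Q - a P. *)
Lemma upper_good_prev m b c x y k : farey m b c x y -> (0 < k < m * c)%N ->
  good m (- (x + y)) (m * (b + c)).+1 k -> good m (- y) (m * c) k.
Proof.
move=> [m0 c0 e] k0 /goodP[] // z.
pose a := - (k%:Z * y) - z * (m * c)%:Z.
pose v := - (k%:Z * x) - z * (m * b).+1%:Z.
have -> : k%:Z * - (x + y) - z * (m * (b + c)).+1%:Z = a + v by rewrite /a /v; lia.
have ke : k%:Z = v * (m * c)%:Z - a * (m * b).+1%:Z.
  by rewrite -[LHS]mulr1 -e /a /v; ring.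
move=> z0 zm; have s : a + v <= b%:Z + c%:Z by nia.
have a0 : 0 <= a.
  rewrite leNgt; apply/negP => aN.
  have h1 : 1 * (m * c)%:Z <= v * (m * c)%:Z by rewrite ler_wpM2r //; lia.
  have h2 : a * (m * b).+1%:Z <= 0 by rewrite mulr_le0_ge0 //; lia.
  lia.
have ac : a <= c%:Z - 1.
  rewrite leNgt; apply/negP => aN.
  have h1 : v * (m * c)%:Z <= b%:Z * (m * c)%:Z by rewrite ler_wpM2r //; lia.
  have h2 : c%:Z * (m * b).+1%:Z <= a * (m * b).+1%:Z by rewrite ler_wpM2r //; lia.
  lia.
apply/goodP => //; first lia.
by exists z; rewrite mulrN -/a //; nia.
Qed.

Lemma upper_good_lower m b c x y k : farey m b c x y -> (0 < k <= (m * b).+1)%N ->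
  good m (- (y + m%:Z * x)) (m * (c + (m * b).+1)) k -> good m (- y) (m * c) k.
Proof.
move=> [m0 c0 e] k0 /goodP[] //; first lia.
move=> z.
pose a := - (k%:Z * y) - z * (m * c)%:Z.
pose v := - (k%:Z * x) - z * (m * b).+1%:Z.
have -> : k%:Z * - (y + m%:Z * x) - z * (m * (c + (m * b).+1))%:Z = a + m%:Z * v.
  by rewrite /a /v !PoszM PoszD -[(m * b).+1]addn1 PoszD PoszM; ring.
have ke : k%:Z = v * (m * c)%:Z - a * (m * b).+1%:Z.
  by rewrite -[LHS]mulr1 -e /a /v; ring.
move=> z0 zm; have s : a + m%:Z * v <= c%:Z + (m * b)%:Z by nia.
have a0 : 0 <= a.
  rewrite leNgt; apply/negP => aN.
  have v1 : 1 <= v by nia.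
  have h1 : 1 * (m * c)%:Z <= v * (m * c)%:Z by rewrite ler_wpM2r //; lia.
  have h2 : a * (m * b).+1%:Z <= -1 * (m * b).+1%:Z by rewrite ler_wpM2r //; lia.
  have : (0 < m * c)%N by rewrite muln_gt0 m0.
  lia.
have ac : a <= c%:Z - 1.
  rewrite leNgt; apply/negP => aN.
  have vb : v <= b%:Z by rewrite -(@ler_pM2l _ m%:Z) //; lia.
  have h1 : v * (m * c)%:Z <= b%:Z * (m * c)%:Z by rewrite ler_wpM2r.
  have h2 : c%:Z * (m * b).+1%:Z <= a * (m * b).+1%:Z by rewrite ler_wpM2r //; lia.
  lia.
apply/goodP => //; first lia.
by exists z; rewrite mulrN -/a //; nia.
Qed.

(** Subtracting P from the vector raises its determinant d with the refined
upper fraction by 1.  Goodness can therefore be lost only at the largest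
admissible value d = c + m b, and this value is attained only at c units before
the end of a period. *)
Lemma upper_good_shift m b c x y k : farey m b c x y -> (0 < k)%N ->
  ((m * b).+1 + k + c < m * (c + (m * b).+1))%N ->
  good m (- (y + m%:Z * x)) (m * (c + (m * b).+1)) ((m * b).+1 + k) ->
  good m (- (y + m%:Z * x)) (m * (c + (m * b).+1)) k.
Proof.
move=> [m0 c0 e] k0 kq /goodP[] //; first lia.
move=> z.
set q := (m * (c + (m * b).+1))%N in kq *.
set j := ((m * b).+1 + k)%N in kq *.
set d := j%:Z * _ - _ => z0 zm.
have qE : q%:Z = (m * c)%:Z + m%:Z * (m * b).+1%:Z by rewrite /q !PoszM PoszD; ring.
pose v := - (j%:Z * x) - z * (m * b).+1%:Z.
have je : j%:Z = v * q%:Z - d * (m * b).+1%:Z.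
  by rewrite -[LHS]mulr1 -e /d /v qE; ring.
have dg : d <= c%:Z + (m * b)%:Z.
  have : m%:Z * d < m%:Z * (c%:Z + (m * b).+1%:Z) by apply: lt_le_trans zm _; lia.
  by rewrite ltr_pM2l //; lia.
have dE : k%:Z * - (y + m%:Z * x) - (z + x) * q%:Z = d + 1.
  rewrite -e /d qE /j PoszD; ring.
apply/goodP => //; first lia.
exists (z + x); rewrite dE; first lia.
(* At the extreme value, j + c is a multiple of the period q, while it lies
   strictly between 0 and q. *)
have dg' : d + 1 <= c%:Z + (m * b)%:Z.
  rewrite leNgt; apply/negP => dgt; have dM : d = c%:Z + m%:Z * b%:Z by lia.
  have jc : (j + c)%:Z = (v - b%:Z) * q%:Z.
    by rewrite PoszD je qE dM -[(m * b).+1]addn1 PoszD !PoszM; ring.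
  have v1 : 0 < v - b%:Z.
    by rewrite -(@pmulr_lgt0 _ q%:Z) -?jc; lia.
  have : 1 * q%:Z <= (v - b%:Z) * q%:Z by rewrite ler_wpM2r //; lia.
  lia.
have : m%:Z * (d + 1) <= m%:Z * (c%:Z + (m * b)%:Z) by rewrite ler_pM2l.
lia.
Qed.

(** * Heaviness and lightness along refinements *)

Lemma coprimez_det (p q a b : int) : a * q - p * b = 1 -> coprimez p q.
Proof. by move=> e; apply/coprimezP; exists (- b, a); rewrite /= -e; ring. Qed.

(** Up to the old denominator the heaviness of x is inherited; beyond it, the
reflection leaves fewer than m c indices, for which the lightness of y
applies. *)
Lemma heavy_lower_next m b c x y : farey m b c x y ->
  heavy_lower m b x -> light_upper m c y -> heavy_lower m (b + c) (x + y).
Proof.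
move=> F H L; have [m0 c0 e] := F.
have cop : coprimez (x + y) (m * (b + c)).+1%:Z.
  apply: (@coprimez_det _ _ y (m * c)%:Z).
  by rewrite -e mulnDr -[(_ + _).+1]addSn PoszD; ring.
apply: (@periodic_many _ m (m * (b + c)).+1) => // [k|n].
  by rewrite good_period.
rewrite leq_eqVlt => /orP[/eqP->|].
  rewrite -[X in hits _ X]addn1 hitsD good_total // mulKn // /hits big_nat1.
  by rewrite addn1 -[X in good _ _ _ X]addn0 good_period good0 //; lia.
rewrite ltnS => nr; case: (leqP n (m * b).+1) => nq.
  apply: leq_trans (H n) _; rewrite leq_mul2l; apply/orP; right.
  by apply: hits_mono => k kn; apply: lower_good_next F _; lia.
have := hits_good_rev m0 cop nr; rewrite mulKn // => rev.
have h : (m * hits (good m (- (x + y)) (m * (b + c)).+1) (m * (b + c) - n) <= m * (b + c) - n)%N.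
  apply: leq_trans (L _); rewrite leq_mul2l; apply/orP; right.
  by apply: hits_mono => k kn; apply: upper_good_prev F _; lia.
have := congr1 (muln m) rev; rewrite mulnDr.
lia.
Qed.

(** Up to c units before the end of the period, shifting by m b + 1 reduces the
count to n <= m b + 1, where the lightness of y is inherited; the remaining
values of n are reflected to less than c indices, for which the heaviness of x
applies. *)
Lemma light_upper_next m b c x y : farey m b c x y ->
  heavy_lower m b x -> light_upper m c y ->
  light_upper m (c + (m * b).+1) (y + m%:Z * x).
Proof.
move=> F H L; have [m0 c0 e] := F.
rewrite /light_upper.
have [r qr] : exists r, (m * (c + (m * b).+1) = r.+1)%N.
  by exists (m * (c + (m * b).+1)).-1; lia.
have cop : coprimez (y + m%:Z * x) r.+1%:Z.
  rewrite coprimez_sym; apply: (@coprimez_det _ _ (m * b).+1%:Z x).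
  by rewrite -qr [(m * (_ + _))%:Z]PoszM PoszD -e PoszM; ring.
have copN : coprimez (- (y + m%:Z * x)) r.+1%:Z by rewrite /coprimez gcdNz.
have rm : (r %/ m = c + m * b)%N.
  have -> : r = ((c + m * b) * m + m.-1)%N by lia.
  by rewrite divnMDl // divn_small ?addn0 // prednK.
(* r + 1 is the period, so r - c is the range of the shift. *)
have short n : (n <= r - c)%N ->
    (m * hits (good m (- (y + m%:Z * x)) (m * (c + (m * b).+1))) n <= n)%N.
  apply: (@periodic_few _ m (m * b).+1) => // [k k0 kr|{}n nq].
    by apply: upper_good_shift F k0 _; lia.
  apply: leq_trans (L n); rewrite leq_mul2l; apply/orP; right.
  by apply: hits_mono => k kn; apply: upper_good_lower F _; lia.
move=> n; apply: (@periodic_few _ m r.+1 n) => // [k _ _|{}n].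
  by rewrite qr good_period.
rewrite leq_eqVlt => /orP[/eqP->|].
  rewrite qr -[X in hits _ X]addn1 hitsD good_total // rm /hits big_nat1.
  by rewrite addn1 -[X in good _ _ _ X]addn0 good_period good0 //; lia.
rewrite ltnS => nr; case: (leqP n (r - c)) => [/short //|nc].
have := hits_good_rev m0 copN nr; rewrite rm opprK -qr => rev.
have h : (r - n <= m * hits (good m (y + m%:Z * x) (m * (c + (m * b).+1))) (r - n))%N.
  apply: leq_trans (H _) _; rewrite leq_mul2l; apply/orP; right.
  by apply: hits_mono => k kn; apply: lower_good_upper F _; lia.
have := congr1 (muln m) rev; rewrite mulnDr.
lia.
Qed.

Lemma farey_next_lower m b c x y : farey m b c x y -> farey m (b + c) c (x + y) y.
Proof.
move=> [m0 c0 e]; split=> //.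
by rewrite -e mulnDr -[(_ + _).+1]addSn PoszD; ring.
Qed.

Lemma farey_next_upper m b c x y : farey m b c x y ->
  farey m b (c + (m * b).+1) x (y + m%:Z * x).
Proof.
move=> [m0 c0 e]; split=> //; first lia.
by rewrite -e mulnDr PoszD [(m * (m * b).+1)%:Z]PoszM; ring.
Qed.

Lemma heavy_lower_start m (x : int) : (0 < m)%N -> heavy_lower m 0 x.
Proof.
move=> m0 n; rewrite (eq_hits (g := fun=> true)) => [|k _].
  by rewrite /hits sum_nat_const_nat; nia.
by rewrite /good muln0 modz1 mulr0.
Qed.

Lemma light_upper_start m (x : int) : (0 < m)%N -> light_upper m 1 (1 + m%:Z * x).
Proof.
move=> m0; rewrite /light_upper muln1 => n.
case: m m0 => // r _.
have cop : coprimez (- (1 + r.+1%:Z * x)) r.+1%:Z.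
  by rewrite coprimez_sym; apply: (@coprimez_det _ _ (-1) x); ring.
have none : hits (good r.+1 (- (1 + r.+1%:Z * x)) r.+1) r = 0%N.
  by rewrite good_total // divn_small.
apply: (@periodic_few _ r.+1 r.+1 n) => // [k _ _|{}n].
  by rewrite good_period.
rewrite leq_eqVlt => /orP[/eqP->|].
  rewrite -[X in hits _ X]addn1 hitsD none /hits big_nat1.
  by rewrite -[leqRHS]muln1 leq_mul2l; case: good.
rewrite ltnS => nr; move: none; rewrite -(subnKC nr) hitsD.
by move=> /eqP; rewrite addn_eq0 => /andP[/eqP-> _]; rewrite muln0.
Qed.

(** * Heavy numbers and best lower denominators *)

Lemma frac_part_ge0 (R : realType) (t : R) : 0 <= frac_part t.
Proof. by rewrite /frac_part subr_ge0 floor_le. Qed.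

Lemma frac_part_le (R : realType) (t : R) (z : int) : z%:~R <= t -> frac_part t <= t - z%:~R.
Proof. by move=> zt; rewrite /frac_part lerD2l lerN2 ler_int floor_ge_int. Qed.

Definition near_above (R : realType) (m : nat) (alpha : R) (k : nat) : bool :=
  frac_part (k%:R * alpha) < 1 / m%:R.

Lemma heavy_setP (R : realType) (m : nat) (alpha : R) : (0 < m)%N ->
  heavy_set R m alpha <-> forall n, (n <= m * hits (near_above m alpha) n)%N.
Proof.
move=> m0.
have cardE n : #|[pred k : 'I_n.+1 | (0 < k)%N && (frac_part (k%:R * alpha) < 1 / m%:R)]|
    = hits (near_above m alpha) n.
  rewrite -sum1_card big_mkcond /= big_ord_recl /= add0n /hits big_add1 /= big_mkord.
  by apply: eq_bigr => k _; rewrite inE /= /near_above /bump /= add1n; case: ifP.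
split=> [H [|n] // | H n n0].
  have := H n.+1 isT; rewrite cardE ler_pdivrMr ?ltr0n //.
  by rewrite -natrM ler_nat mulnC.
by rewrite cardE ler_pdivrMr ?ltr0n // -natrM ler_nat mulnC.
Qed.

Definition best_lower (R : realType) (alpha : R) (q : nat) : Prop :=
  (0 < q)%N /\ forall k, (0 < k < q)%N -> frac_part (q%:R * alpha) < frac_part (k%:R * alpha).

(** If g > 1 divided both p and q, then (q / g) alpha would exceed the integer
p / g by 1 / g of {q alpha}, against the minimality of {q alpha}. *)
Lemma best_lower_coprime (R : realType) (alpha : R) q :
  best_lower alpha q -> coprimez (Num.floor (q%:R * alpha)) q%:Z.
Proof.
move=> [q0 best]; set p := Num.floor _.
have [a pa] : exists a, p = a * gcdz p q%:Z by apply/dvdzP/dvdz_gcdl.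
have /dvdnP[b qb] := dvdn_gcdr `|p| q.
rewrite /coprimez; move: pa qb; rewrite /gcdz absz_nat; move: (gcdn_gt0 `|p| q); rewrite q0 orbT.
set g := gcdn _ _ => g0 pa qb.
case: (ltngtP g 1) => [|g1|->]//; first lia.
have bq : (0 < b < q)%N by nia.
have := best b bq; rewrite ltNge => /negP[].
have pE : p%:~R = a%:~R * g%:R :> R by rewrite pa intrM.
have qE : q%:R = b%:R * g%:R :> R by rewrite {1}qb natrM.
have gR : 1 <= g%:R :> R by rewrite ler1n.
have f0 : 0 <= b%:R * alpha - a%:~R.
  rewrite -(@pmulr_lge0 _ g%:R) ?ltr0n //.
  have := frac_part_ge0 (q%:R * alpha); rewrite /frac_part -/p pE qE; lra.
apply: (@le_trans _ _ (b%:R * alpha - a%:~R)); first by apply: frac_part_le; lra.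
rewrite /frac_part -/p pE qE.
have : (b%:R * alpha - a%:~R) * 1 <= (b%:R * alpha - a%:~R) * g%:R by rewrite ler_wpM2l.
lra.
Qed.

(** Each k < q that counts for alpha counts for p / q, where p is the floor of
q alpha, and never with residue 0. *)
Lemma heavy_best_lower (R : realType) m (alpha : R) q : (0 < m)%N ->
  heavy_set R m alpha -> best_lower alpha q -> (m %| q.-1)%N.
Proof.
move=> m0 /(heavy_setP _ m0) H best; have cop := best_lower_coprime best.
case: q best cop => [[]//|r] [_ best] /=.
set p := Num.floor _ => cop.
have le : (hits (near_above m alpha) r <= r %/ m)%N.
  rewrite -(good_total m0 cop); apply: hits_mono => k kr near.
  have := best k; rewrite ltnS kr => /(_ isT) lt.
  have mR : 0 < m%:R :> R by rewrite ltr0n.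
  move: near; rewrite /near_above ltr_pdivlMr // => near.
  pose z := Num.floor (k%:R * alpha).
  (* The remainder k p - z q is q {k alpha} - k {q alpha}, hence between 0 and
     q {k alpha} by minimality of {q alpha}. *)
  have dE : (k%:Z * p - z * r.+1%:Z)%:~R =
      r.+1%:R * frac_part (k%:R * alpha) - k%:R * frac_part (r.+1%:R * alpha) :> R.
    by rewrite /frac_part -/p -/z intrB !intrM -[k%:Z%:~R]/(k%:R) -[r.+1%:Z%:~R]/(r.+1%:R); ring.
  have f0 := frac_part_ge0 (r.+1%:R * alpha).
  have h1 : k%:R * frac_part (r.+1%:R * alpha) <= r.+1%:R * frac_part (r.+1%:R * alpha).
    by rewrite ler_wpM2r // ler_nat; lia.
  have h2 : r.+1%:R * frac_part (r.+1%:R * alpha) < r.+1%:R * frac_part (k%:R * alpha).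
    by rewrite ltr_pM2l // ltr0n.
  have h3 : r.+1%:R * (frac_part (k%:R * alpha) * m%:R) < r.+1%:R * 1.
    by rewrite ltr_pM2l // ltr0n.
  apply/goodP => //; exists z; first by rewrite -(ler0z R) dE; lra.
  rewrite -(ltr_int R) intrM dE -[m%:Z%:~R]/(m%:R) -[r.+1%:Z%:~R]/(r.+1%:R).
  have : 0 <= m%:R * (k%:R * frac_part (r.+1%:R * alpha)) by rewrite !mulr_ge0.
  lra.
have : (r <= m * (r %/ m))%N.
  by apply: leq_trans (H r) _; rewrite leq_mul2l le orbT.
by rewrite /dvdn; have := divn_eq r m; lia.
Qed.

(** In the basis X = (a, p), Y = (b, r), a vector (k, z) below the line of slope
alpha with 0 < k < a has a positive coordinate on X and a negative one on Y,
and Y lies above the line: so (k, z) is further below than X. *)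
Lemma best_lower_farey (R : realType) (alpha : R) (a b : nat) (p r : int) : (0 < a)%N ->
  r * a%:Z - p * b%:Z = 1 -> p%:~R <= a%:R * alpha -> b%:R * alpha < r%:~R ->
  best_lower alpha a.
Proof.
move=> a0 e pa br; split=> // k /andP[k0 ka].
apply: le_lt_trans (frac_part_le pa) _.
rewrite /frac_part; set z := Num.floor _.
have z0 : 0 <= k%:R * alpha - z%:~R by exact: frac_part_ge0.
pose u := k%:Z * r - z * b%:Z; pose v := z * a%:Z - k%:Z * p.
have kZ : k%:Z = u * a%:Z + v * b%:Z by rewrite -[LHS]mulr1 -e /u /v; ring.
have kE : k%:R = u%:~R * a%:R + v%:~R * b%:R :> R.
  by rewrite -[k%:R]/(k%:Z%:~R) kZ intrD !intrM.
have zE : z%:~R = u%:~R * p%:~R + v%:~R * r%:~R :> R.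
  rewrite -!intrM -intrD; congr intmul.
  by rewrite -[LHS]mulr1 -e /u /v; ring.
set f := a%:R * alpha - p%:~R; set g := b%:R * alpha - r%:~R.
have f0 : 0 <= f by rewrite /f; lra.
have g0 : g < 0 by rewrite /g; lra.
have E : k%:R * alpha - z%:~R = u%:~R * f + v%:~R * g by rewrite kE zE /f /g; ring.
rewrite E in z0 *.
have u1 : 1 <= u.
  rewrite leNgt; apply/negP => u0; have u0' : u <= 0 by lia.
  have v0 : v <= 0.
    rewrite leNgt; apply/negP => v0; move: z0; rewrite leNgt => /negP[].
    have : u%:~R * f <= 0 by rewrite mulr_le0_ge0 // lerz0.
    have : v%:~R * g < 0 by rewrite nmulr_llt0 // ltr0z.
    lra.
  have : u * a%:Z <= 0 by rewrite mulr_le0_ge0.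
  have : v * b%:Z <= 0 by rewrite mulr_le0_ge0.
  lia.
have vN : v < 0.
  rewrite ltNge; apply/negP => v0.
  have : 1 * a%:Z <= u * a%:Z by rewrite ler_wpM2r.
  have : 0 <= v * b%:Z by rewrite mulr_ge0.
  lia.
have : 1 * f <= u%:~R * f by rewrite ler_wpM2r // ler1z.
have : 0 < v%:~R * g by rewrite nmulr_lgt0 // ltrz0.
lra.
Qed.

(** * Approximation by Farey pairs *)

(** With (k, z) = u P - d Q, the vector (m k, m z + 1), which lies above the line
when k alpha - z < 1/m, equals (m u - m c) P + (m b + 1 - m d) Q; its
coordinate on P is nonpositive and the one on Q is positive. *)
Lemma lower_good_near (R : realType) (alpha : R) m b c x y k : farey m b c x y ->
  x%:~R <= (m * b).+1%:R * alpha -> (m * c)%:R * alpha < y%:~R ->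
  (0 < k < (m * b).+1 + c)%N -> good m x (m * b).+1 k -> near_above m alpha k.
Proof.
move=> [m0 c0 e] xa ya k0 /goodP[] // z z0 zm.
set d := k%:Z * x - z * (m * b).+1%:Z in z0 zm.
have db : d <= b%:Z by nia.
pose u := k%:Z * y - z * (m * c)%:Z.
have ke : k%:Z = u * (m * b).+1%:Z - d * (m * c)%:Z.
  by rewrite -[LHS]mulr1 -e /u /d; ring.
have ze : z = u * x - d * y.
  by rewrite -[LHS]mulr1 -e /u /d; ring.
have /andP[u1 uc] : 1 <= u <= c%:Z by apply: lower_good_coord ke; lia.
clearbody u d; set f := (m * b).+1%:R * alpha - x%:~R; set g := (m * c)%:R * alpha - y%:~R.
have f0 : 0 <= f by rewrite /f; lra.
have g0 : g < 0 by rewrite /g; lra.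
have E : k%:R * alpha - z%:~R = u%:~R * f - d%:~R * g.
  have -> : k%:R = u%:~R * (m * b).+1%:R - d%:~R * (m * c)%:R :> R.
    by rewrite -[k%:R]/(k%:Z%:~R) ke intrB !intrM.
  rewrite [in LHS]ze intrB !intrM /f /g. ring.
have E1 : 1 = (m * c)%:R * f - (m * b).+1%:R * g.
  have : y%:~R * (m * b).+1%:R - x%:~R * (m * c)%:R = 1 :> R by rewrite -[RHS]/(1%:~R) -e intrB !intrM.
  by move=> det; rewrite -[LHS]det /f /g; ring.
have uR : 1 <= u%:~R :> R by rewrite ler1z.
have dR : 0 <= d%:~R :> R by rewrite ler0z.
rewrite /near_above ltr_pdivlMr ?ltr0n //.
have zk : z%:~R <= k%:R * alpha.
  rewrite -subr_ge0 E addr_ge0 // ?mulr_ge0 //; first lra.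
  by rewrite -mulrN mulr_ge0 //; lra.
apply: (@le_lt_trans _ _ ((k%:R * alpha - z%:~R) * m%:R)).
  by rewrite ler_wpM2r // frac_part_le.
rewrite E [ltRHS]E1.
have h1 : (u%:~R * m%:R) * f <= (m * c)%:R * f.
  rewrite ler_wpM2r // natrM mulrC ler_wpM2l //.
  by rewrite -[c%:R]/(c%:Z%:~R) ler_int.
have h2 : (m * b).+1%:R * g < d%:~R * m%:R * g.
  rewrite ltr_nM2r // -[m%:R]/(m%:Z%:~R) -[_.+1%:R]/(_.+1%:Z%:~R) -intrM ltr_int.
  by rewrite mulrC.
lra.
Qed.

(** Once P + Q is above alpha, so is Q + t P for all t <= m: the first failure,
at t + 1, would make Q + (t + 1) P a best lower approximation by
[best_lower_farey], with denominator congruent to t + 1 modulo m and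
1 < t + 1 <= m.  The case c = 0, where Q = (0, 1), serves to
start the approximation. *)
Lemma best_lower_upper_jump (R : realType) (alpha : R) (m b c : nat) (x y : int) :
  (0 < m)%N -> (forall q, best_lower alpha q -> (m %| q.-1)%N) ->
  y * (m * b).+1%:Z - x * (m * c)%:Z = 1 ->
  ((m * b).+1 + m * c)%:R * alpha < (x + y)%:~R ->
  (m * (c + (m * b).+1))%:R * alpha < (y + m%:Z * x)%:~R.
Proof.
move=> m0 best e lt.
suff H t : (0 < t <= m)%N -> (m * c + t * (m * b).+1)%:R * alpha < (y + t%:Z * x)%:~R.
  by have := H m; rewrite m0 leqnn mulnDr; apply.
elim: t => // -[_ _|t IH tm]; first by rewrite mul1n mul1r addnC [y + x]addrC.
rewrite ltNge; apply/negP => ge.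
have /best : best_lower alpha (m * c + t.+2 * (m * b).+1).
  apply: (best_lower_farey _ _ ge (IH _)); [lia| |lia].
  by rewrite -e !PoszD !PoszM -[t.+2]addn1 -[t.+1]addn1 !PoszD; ring.
have -> : ((m * c + t.+2 * (m * b).+1).-1 = m * (c + t.+2 * b) + t.+1)%N.
  by rewrite mulnDr mulnS [(m * (t.+2 * b))%N]mulnCA; lia.
rewrite dvdn_addr ?dvdn_mulr // => /(dvdn_leq (ltn0Sn t)) mt.
by move: tm; rewrite /= ltnNge mt.
Qed.

(** The starting pair is floor(alpha) / 1 and the refinement by m of the formal
pair P = (1, floor alpha), Q = (0, 1). *)
Lemma heavy_farey_approx (R : realType) (alpha : R) (m N : nat) :
  (0 < m)%N -> (forall q, best_lower alpha q -> (m %| q.-1)%N) ->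
  exists b c x y, [/\ farey m b c x y, heavy_lower m b x, light_upper m c y,
    x%:~R <= (m * b).+1%:R * alpha /\ (m * c)%:R * alpha < y%:~R & (N < b + c)%N].
Proof.
move=> m0 best; elim: N => [|N [b [c [x [y [F H L [xa ya] bc]]]]]].
  have /andP[fa af] := floor_itv alpha; set x := Num.floor alpha in fa af.
  exists 0%N, 1%N, x, (1 + m%:Z * x); split=> //.
  - by split=> //; rewrite muln0 muln1; ring.
  - exact: heavy_lower_start.
  - exact: light_upper_start.
  - split; first by rewrite muln0 mul1r.
    have := @best_lower_upper_jump R alpha m 0 0 x 1 m0 best.
    rewrite !muln0 mulr0 subr0 mul1r addn0 mul1r => /(_ erefl); exact.
have [m0' c0 e] := F.
have [ge|lt] := leP (x + y)%:~R (((m * b).+1 + m * c)%:R * alpha).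
  exists (b + c)%N, c, (x + y), y; split=> //; last lia.
  - exact: farey_next_lower.
  - exact: heavy_lower_next F H L.
  - by split=> //; rewrite mulnDr -addSn.
exists b, (c + (m * b).+1)%N, x, (y + m%:Z * x); split=> //; last lia.
- exact: farey_next_upper.
- exact: light_upper_next F H L.
- by split=> //; apply: best_lower_upper_jump.
Qed.

Lemma heavy_set_best_lowerP (R : realType) (m : nat) (alpha : R) : (0 < m)%N ->
  heavy_set R m alpha <-> forall q, best_lower alpha q -> (m %| q.-1)%N.
Proof.
move=> m0; split=> [H q|best]; first exact: heavy_best_lower.
apply/heavy_setP => // n.
have [b [c [x [y [F H _ [xa ya] bc]]]]] := heavy_farey_approx n m0 best.
apply: leq_trans (H n) _; rewrite leq_mul2l; apply/orP; right.
have bmb : (b <= m * b)%N by rewrite leq_pmull.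
by apply: hits_mono => k kn; apply: lower_good_near F xa ya _; lia.
Qed.

Theorem corollary1 (R : realType) (m n : nat) (hm : (0 < m)%N) (hn : (0 < n)%N) :
  heavy_set R m `&` heavy_set R n = heavy_set R (lcmn m n).
Proof.
have hl : (0 < lcmn m n)%N by rewrite lcmn_gt0 hm.
apply/seteqP; split=> alpha.
  move=> [/(heavy_set_best_lowerP _ hm) Hm /(heavy_set_best_lowerP _ hn) Hn].
  by apply/heavy_set_best_lowerP => // q Q; rewrite dvdn_lcm Hm ?Hn.
move=> /(heavy_set_best_lowerP _ hl) H.
by split; apply/heavy_set_best_lowerP => // q /H; rewrite dvdn_lcm => /andP[].
Qed.
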